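(* Let $T$ be a tree with color classes $B$ and $W$, let $n$ be a positive integer, and let $g: T^n \to \mathbf{R} \cup \{\infty\}$ be an L-convex function. If $x \in \mathrm{dom}\, g$ is not a minimizer of $g$, then there exists $x' \in \mathcal{I}(x) \cup \mathcal{F}(x)$ with $g(x') < g(x)$.
   Context: The vertex set of a tree $T$ is also denoted by $T$, and $d$ denotes its path metric. $T$ is regarded as a bipartite graph with color classes $B$ (black vertices) and $W$ (white vertices). Define a partial order on $T$ by: $u \prec v$ iff $u,v$ are adjacent with $u \in W$, $v \in B$. $T^n$ carries the product order, also denoted $\preceq$. For $x \in T^n$, $\mathcal{I}(x) := \{y \in T^n \mid y \preceq x\}$ and $\mathcal{F}(x) := \{y \in T^n \mid y \succeq x\}$. For $u,v \in T$ there is a unique pair $(a,b)$ of vertices with $d(u,v) = d(u,a)+d(a,b)+d(b,v)$, $d(u,a)=d(b,v)$ and $d(a,b) \le 1$. Define $u \bullet v$ and $u \circ v$ by $\{u\bullet v, u \circ v\} = \{a,b\}$ and $u \circ v \preceq u \bullet v$ (so if $a=b$ both equal $a$; otherwise $u \bullet v$ is the black one and $u\circ v$ the white one). On $T^n$ the operations $\bullet,\circ$ are defined componentwise. A function $g: T^n \to \mathbf{R}\cup\{\infty\}$ is (alternating) L-convex if $g(x)+g(y) \ge g(x \bullet y) + g(x \circ y)$ for all $x,y \in T^n$. $\mathrm{dom}\, g := \{x \mid g(x) \ne \infty\}$. *)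

(* Defs.v *)
From mathcomp Require Import all_boot all_order all_algebra zify.
From mathcomp Require Import boolp classical_sets reals constructive_ereal.

Set Implicit Arguments.
Unset Strict Implicit.
Unset Printing Implicit Defensive.

(** A tree, possibly infinite, with its two color classes: [black] is the class
    B and its complement is the class W. Walks are ssreflect paths: [u :: p] is
    a walk from [u] to [last u p] of length [size p]. *)
Record bitree := BiTree {
  vertex :> eqType;
  adj : rel vertex;
  black : pred vertex;
  adj_sym : symmetric adj;
  adj_irr : irreflexive adj;
  adj_conn : forall u v, exists p, path adj u p /\ last u p = v;
  (* The [ucycle]s of size at most 2 are the empty one, the single vertices
     (excluded by irreflexivity) and the edges traversed back and forth. *)
  adj_acyclic : forall c : seq vertex, ucycle adj c -> size c <= 2;
  adj_black : forall u v, adj u v -> black u != black v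
}.

Section Tree.
Variable T : bitree.
Implicit Types (u v w a b : T) (p q : seq T).

Lemma walk_ex u v : exists k,
  `[< exists p, [/\ path (@adj T) u p, last u p = v & size p = k] >].
Proof.
have [p [pp lp]] := adj_conn u v.
by exists (size p); apply/asboolP; exists p.
Qed.

Definition dist u v : nat := ex_minn (walk_ex u v).

Lemma geodesic u v :
  exists p, [/\ path (@adj T) u p, last u p = v & size p = dist u v].
Proof. by rewrite /dist; case: ex_minnP => k /asboolP. Qed.

Lemma dist_le u p : path (@adj T) u p -> dist u (last u p) <= size p.
Proof.
move=> pp; rewrite /dist; case: ex_minnP => k _; apply.
by apply/asboolP; exists p.
Qed.

Lemma dist_tri u v w : dist u w <= dist u v + dist v w.
Proof.
have [p [pp <- <-]] := geodesic u v.
have [q [pq <- <-]] := geodesic (last u p) w.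
by rewrite -size_cat -last_cat dist_le // cat_path pp.
Qed.

Lemma dist_geodesic u p i j : path (@adj T) u p ->
  size p = dist u (last u p) -> i <= j <= size p ->
  dist (last u (take i p)) (last u (take j p)) = j - i.
Proof.
move=> pp sp /andP[ij jp].
have pj : path (@adj T) u (take j p) by rewrite take_path.
have pi : path (@adj T) u (take i p) by rewrite take_path.
have tij : take i p = take i (take j p) by rewrite take_takel.
have d1 := dist_le pi.
have d2 : dist (last u (take i p)) (last u (take j p)) <= j - i.
  have := pj; rewrite -(cat_take_drop i (take j p)) -tij cat_path last_cat.
  case/andP=> _ /dist_le; rewrite size_drop size_takel //.
have d3 : dist (last u (take j p)) (last u p) <= size p - j.
  have := pp; rewrite -{1 2}(cat_take_drop j p) cat_path => /andP[_ /dist_le].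
  by rewrite -last_cat cat_take_drop size_drop.
have t1 := dist_tri u (last u (take i p)) (last u p).
have t2 := dist_tri (last u (take i p)) (last u (take j p)) (last u p).
move: d1; rewrite size_takel; lia.
Qed.

Lemma geodesic_uniq u p :
  path (@adj T) u p -> size p = dist u (last u p) -> uniq (u :: p).
Proof.
move=> pp; case: (shortenP pp) => p' pp' up' sub sp.
apply: (leq_size_uniq up').
  by move=> x; rewrite !inE => /orP[->//|/sub ->]; rewrite orbT.
by rewrite /= sp ltnS; exact: dist_le.
Qed.

Lemma simple_path_unique u p q :
  path (@adj T) u p -> path (@adj T) u q -> last u p = last u q ->
  uniq (u :: p) -> uniq (u :: q) -> p = q.
Proof.
elim: p u q => [|x p IH] u [|y q] //=.
- by move=> _ _ -> _; rewrite mem_last.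
- by move=> _ _ <-; rewrite mem_last.
move=> /andP[ux pp] /andP[uy pq] l up uq.
have [xy|xy] := eqVneq x y.
  by subst y; congr (_ :: _); apply: IH pp pq l _ _; [case/andP: up|case/andP: uq].
have hp : has [in y :: q] (x :: p).
  by apply/hasP; exists (last x p); [exact: mem_last | rewrite l; exact: mem_last].
have Pp : path (@adj T) u (x :: p) by rewrite /= ux.
have Pq : path (@adj T) u (y :: q) by rewrite /= uy.
have Up : uniq (u :: x :: p) by [].
have Uq : uniq (u :: y :: q) by [].
have hx : forall s1 z s2, x :: p = rcons s1 z ++ s2 -> s1 = [::] -> x = z.
  by move=> s1 z s2 /[swap] -> [].
have hy : forall s1 z s2, y :: q = rcons s1 z ++ s2 -> s1 = [::] -> y = z.
  by move=> s1 z s2 /[swap] -> [].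
move: Pp Pq Up Uq hp hx hy xy; move: (x :: p) (y :: q) => P Q PP PQ UP UQ hp.
case: (split_find hp) PP UP => z p1 p2 zQ np1 PP UP hx.
case/path.splitP: zQ np1 PQ UQ => q1 q2 np1 PQ UQ hy xy.
have n0 : 0 < size p1 + size q1.
  rewrite lt0n addn_eq0; apply/negP => /andP[/nilP e1 /nilP e2].
  by case/negP: xy; apply/eqP; rewrite (hx _ _ _ erefl e1) (hy _ _ _ erefl e2).
have : size (u :: p1 ++ z :: rev q1) <= 2.
  apply: adj_acyclic; apply/andP; split.
    rewrite /= rcons_cat /= cat_path /=.
    move: PP; rewrite cat_path rcons_path => /andP[/andP[-> ->] _] /=.
    move: PQ; rewrite cat_path => /andP[PQ _].
    have := rev_path (@adj T) u (rcons q1 z).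
    rewrite last_rcons belast_rcons rev_cons => ->.
    by rewrite (eq_path (e' := @adj T)) // => a b; rewrite adj_sym.
  move: UP UQ; rewrite /= !cat_uniq !mem_cat !rcons_uniq !mem_rcons !inE !negb_or.
  case/and3P=> /andP[/andP[uz up1] _] /andP[zp1 U1] _.
  case/and3P=> /andP[/andP[_ uq1] _] /andP[zq1 U2] _.
  rewrite /= !mem_rev rev_uniq uz up1 uq1 U1 zq1 U2 (negbTE zp1) /= !andbT.
  apply/hasPn => a; rewrite mem_rev => aq1; apply/negP => ap1.
  case/hasP: np1; exists a => //=.
  by rewrite mem_cat mem_rcons inE aq1 orbT.
by rewrite /= size_cat /= size_rev addnS !ltnS leqNgt n0.
Qed.

Definition midpair u v (ab : T * T) :=
  [/\ dist u v = dist u ab.1 + dist ab.1 ab.2 + dist ab.2 v,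
      dist u ab.1 = dist ab.2 v & dist ab.1 ab.2 <= 1].

Lemma midpair_ex u v : exists ab, midpair u v ab.
Proof.
have [p [pp lp sp]] := geodesic u v.
have D i j : i <= j <= size p ->
    dist (last u (take i p)) (last u (take j p)) = j - i.
  by apply: dist_geodesic => //; rewrite lp.
have hE := odd_double_half (size p).
have hb : odd (size p) <= 1 by case: odd.
move: (size p)./2 (nat_of_bool (odd (size p))) hE hb => h o hE hb.
exists (last u (take h p), last u (take (size p - h) p)).
have d1 : dist u (last u (take h p)) = h.
  by have := D 0 h; rewrite take0 subn0; apply; lia.
have d2 : dist (last u (take h p)) (last u (take (size p - h) p)) = o.
  by rewrite D; lia.
have d3 : dist (last u (take (size p - h) p)) v = h.
  by have := D (size p - h) (size p); rewrite take_size lp => ->; lia.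
by rewrite /midpair /= -sp d1 d2 d3; split=> //; lia.
Qed.

Lemma midpair_unique u v ab ab' : midpair u v ab -> midpair u v ab' -> ab = ab'.
Proof.
case: ab ab' => [a b] [a' b'] [/= e1 e2 e3] [/= f1 f2 f3].
have H x y : dist u v = dist u x + dist x y + dist y v ->
    exists p q r, [/\ path (@adj T) u (p ++ q ++ r), uniq (u :: p ++ q ++ r),
      last u p = x /\ last x q = y, last y r = v &
      [/\ size p = dist u x, size q = dist x y & size r = dist y v]].
  move=> e; have [p [pp lp sp]] := geodesic u x.
  have [q [pq lq sq]] := geodesic x y; have [r [pr lr sr]] := geodesic y v.
  exists p, q, r.
  have P : path (@adj T) u (p ++ q ++ r) by rewrite !cat_path pp lp pq lq.
  by split=> //; apply: geodesic_uniq => //;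
    rewrite !last_cat lp lq lr !size_cat sp sq sr e addnA.
have [p [q [r [P U [lp lq] lr [sp sq sr]]]]] := H _ _ e1.
have [p' [q' [r' [P' U' [lp' lq'] lr' [sp' sq' sr']]]]] := H _ _ f1.
have E : p ++ q ++ r = p' ++ q' ++ r'.
  by apply: simple_path_unique P P' _ U U'; rewrite !last_cat lp lq lr lp' lq' lr'.
have /eqP := E; rewrite eqseq_cat; last by lia.
case/andP=> /eqP ep; rewrite eqseq_cat; last by lia.
by case/andP=> /eqP eq _; rewrite -lp -lp' -lq -lq' -lp -lp' ep eq.
Qed.

Definition mid u v : T * T := projT1 (cid (midpair_ex u v)).

Lemma midP u v : midpair u v (mid u v).
Proof. exact: projT2 (cid (midpair_ex u v)). Qed.

Definition prec u v : bool := [&& adj u v, ~~ black u & black v].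

Definition preceq u v : bool := (u == v) || prec u v.

Definition bullet u v : T :=
  let: (a, b) := mid u v in if preceq a b then b else a.

Definition circ u v : T :=
  let: (a, b) := mid u v in if preceq a b then a else b.

Lemma circ_bullet u v : preceq (circ u v) (bullet u v).
Proof.
rewrite /circ /bullet; have := midP u v; case: (mid u v) => a b [/= _ _ d].
case: ifPn => //; rewrite /preceq /prec negb_or => /andP[nab].
have [p [pp lp sp]] := geodesic a b.
case: p pp lp sp => [|x [|y p]] /=; first by move=> _ e; rewrite e eqxx in nab.
  move=> /andP[ab _] e _; subst x; rewrite ab adj_sym ab.
  by have := adj_black ab; do 2 case: black; rewrite ?orbT.
by move=> _ _ s; rewrite -s in d.
Qed.

Section Power.
Variable n : nat.
Implicit Types x y : 'I_n -> T.

Definition bulletn x y : 'I_n -> T := fun i => bullet (x i) (y i).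

Definition circn x y : 'I_n -> T := fun i => circ (x i) (y i).

Definition preceqn x y : Prop := forall i, preceq (x i) (y i).

Definition ideal x : set ('I_n -> T) := [set y | preceqn y x]%classic.

Definition filt x : set ('I_n -> T) := [set y | preceqn x y]%classic.

Section Functions.
Variable R : realType.
Implicit Type g : ('I_n -> T) -> \bar R.

(** Functions to R ∪ {∞} are extended-real functions that avoid -oo. *)
Definition proper_valued g : Prop := forall x, g x != -oo%E.

Definition edom g : set ('I_n -> T) := [set x | g x != +oo%E]%classic.

Definition Lconvex g : Prop :=
  forall x y, (g (bulletn x y) + g (circn x y) <= g x + g y)%E.

Definition minimizer g x : Prop := forall y, (g x <= g y)%E.

End Functions.
End Power.
End Tree.

(* Main.v *)
Require Import Defs.
From mathcomp Require Import all_boot all_order all_algebra zify.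
From mathcomp Require Import boolp classical_sets reals constructive_ereal.

(** If [g y < g x], then L-convexity gives [g z < g x] for [z = x • y] or
    [z = x ∘ y]. Both midpoints are within half the distance (rounded up)
    from [x] to [y], so iterating brings [y] within distance 1 of [x]; at that
    point [x • y] lies in the filter and [x ∘ y] in the ideal of [x]. *)

Section Midpoints.
Context {T : bitree}.
Implicit Types u v : T.

Lemma dist0_eq u v : dist u v = 0 -> u = v.
Proof.
by move=> d0; have [p [_ + +]] := geodesic u v; rewrite d0 => /[swap] /size0nil ->.
Qed.

(** Since [dist u a = dist b v], the distance [dist u v] is twice [dist u a] plus [dist a b], and
    [dist a b] is 0 or 1. Hence even the farther of [a], [b] is at most half of it, rounded up, from
    [u]. *)
Lemma dist_bullet u v : dist u (bullet u v) <= uphalf (dist u v).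
Proof.
rewrite /bullet; have := midP u v; case: (mid u v) => a b [/= e1 e2 e3].
have t := dist_tri u a b.
by case: ifP => _; lia.
Qed.

Lemma dist_circ u v : dist u (circ u v) <= uphalf (dist u v).
Proof.
rewrite /circ; have := midP u v; case: (mid u v) => a b [/= e1 e2 e3].
have t := dist_tri u a b.
by case: ifP => _; lia.
Qed.

Lemma mid_dist1 u v : dist u v <= 1 -> mid u v = (u, v).
Proof.
have := midP u v; case: (mid u v) => a b [/= e1 e2 e3] d.
have -> : u = a by apply: dist0_eq; lia.
by have -> : b = v by apply: dist0_eq; lia.
Qed.

Lemma preceq_bullet u v : dist u v <= 1 -> preceq u (bullet u v).
Proof.
by move=> d; rewrite /bullet mid_dist1 //; case: ifP => // _; rewrite /preceq eqxx.
Qed.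

Lemma circ_preceq u v : dist u v <= 1 -> preceq (circ u v) u.
Proof.
(* If [u] does not precede [v], then [circ u v] is [v] and [bullet u v] is [u], so [circ_bullet] is
   exactly the claim. *)
move=> d; have := circ_bullet u v; rewrite /circ /bullet mid_dist1 //.
by case: ifP => // _ _; rewrite /preceq eqxx.
Qed.

End Midpoints.

Lemma Lconvex_midpoint_lt {R : realType} {T : bitree} {n : nat}
    {g : ('I_n -> T) -> \bar R} {x y : 'I_n -> T} :
  proper_valued g -> Lconvex g -> edom g x -> (g y < g x)%E ->
  (g (bulletn x y) < g x)%E \/ (g (circn x y) < g x)%E.
Proof.
move=> hg hL hx lt_yx; apply/orP; rewrite !Order.TotalTheory.ltNge -negb_and.
apply/negP => /andP[le_b le_c].
(* Were both values at least [g x], L-convexity would give [g x + g x <= g x + g y]; finiteness of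
   [g x] allows cancelling it. *)
have fx : g x \is a fin_num by rewrite fin_numE hg.
have := Order.POrderTheory.le_trans (leeD le_b le_c) (hL x y).
by rewrite leeD2lE // Order.TotalTheory.leNgt lt_yx.
Qed.

Lemma Lconvex_local_descent {R : realType} {T : bitree} {n : nat}
    {g : ('I_n -> T) -> \bar R} {x y : 'I_n -> T} {k : nat} :
  proper_valued g -> Lconvex g -> edom g x -> (g y < g x)%E ->
  (forall i, dist (x i) (y i) <= k) ->
  exists x', (ideal x `|` filt x)%classic x' /\ (g x' < g x)%E.
Proof.
move=> hg hL hx; elim/ltn_ind: k y => k IH y lt_yx le_k.
have [lt_b|lt_c] := Lconvex_midpoint_lt hg hL hx lt_yx.
(* The split is at 1 because [uphalf k < k] fails for [k <= 1]. *)
- have [k1|k1] := leqP k 1.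
    exists (bulletn x y); split=> //; right => i.
    exact: preceq_bullet (leq_trans (le_k i) k1).
  apply: (IH (uphalf k)) lt_b _; first by lia.
  by move=> i; exact: leq_trans (dist_bullet _ _) (uphalf_leq (le_k i)).
- have [k1|k1] := leqP k 1.
    exists (circn x y); split=> //; left => i.
    exact: circ_preceq (leq_trans (le_k i) k1).
  apply: (IH (uphalf k)) lt_c _; first by lia.
  by move=> i; exact: leq_trans (dist_circ _ _) (uphalf_leq (le_k i)).
Qed.

Theorem theorem2p5 (R : realType) (T : bitree) (n : nat) (hn : (0 < n)%N)
    (g : ('I_n -> T) -> \bar R) (hg : proper_valued g) (hL : Lconvex g)
    (x : 'I_n -> T) (hx : edom g x) (hmin : ~ minimizer g x) :
  exists x' : 'I_n -> T, (ideal x `|` filt x)%classic x' /\ (g x' < g x)%E.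
Proof.
have /existsNP[y /negP] := hmin; rewrite -Order.TotalTheory.ltNge => lt_yx.
(* The induction starts from the largest coordinatewise distance between [x] and [y]. *)
apply: (Lconvex_local_descent (k := \max_i dist (x i) (y i))) hg hL hx lt_yx _.
by move=> i; exact: leq_bigmax.
Qed.
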